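(* Let $\psi_L,\psi_R\in V_\nu$ satisfy $$C^*.\psi_L(\bar z,z)=\psi_L(\bar z,z).B,\qquad B^*.\psi_R.B=-\bar\mu\mu\,q^{1-\delta}\,\psi_R.A^{2(\delta-1)},$$ the second condition meaning $B^*.\psi_R(\bar z,z).B=-\bar\mu\mu\,q^{(i\nu-2)(\delta-1)}\psi_R(\bar z,q^{2-2\delta}z)$. Then the matrix element $$F_\nu^{(\delta)}(H)=\langle\psi_L|\psi_R.g(A|H)\rangle$$ satisfies the difference equation $$\frac{qF_\nu^{(\delta)}(qH)-(q^{i\nu}+q^{-i\nu})F_\nu^{(\delta)}(H)+q^{-1}F_\nu^{(\delta)}(q^{-1}H)}{(1-q^2)^2}-\bar\mu\mu\,q^{-\delta-1}H^{-2}F_\nu^{(\delta)}(q^{\delta-1}H)=0.$$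
   Context: Here $q>0$, $q\ne1$ is real, $\delta\in\{0,1,2\}$, $\nu\in\mathbb R$, and $\mu$ is a parameter. $V_\nu$ is the space of the class-one principal series: functions $f(\bar z,z)$ with asymptotics $z^{i\nu-1}\bar z^{i\nu-1}$ as $z\to\infty$; the arguments $\bar z$ and $z$ are treated as independent variables that may be rescaled separately. The following operators act on the $z$-argument (written on the right): $$f.A=q^{\frac{i\nu-1}2}f(\bar z,q^{-1}z),\qquad f.B=q^{\frac{i\nu}2}\frac{f(\bar z,q^{-1}z)-f(\bar z,qz)}{1-q^2}z^{-1},$$ $$f.C=\frac{z}{1-q^2}\Bigl[-q^{\frac{i\nu+2}2}f(\bar z,q^{-1}z)+q^{-\frac{3i\nu}2+3}f(\bar z,qz)\Bigr],$$ and the operators $A^*.f$, $B^*.f$, $C^*.f$ act by the same formulas on the $\bar z$-argument (written on the left), e.g. $C^*.f=\frac{\bar z}{1-q^2}\bigl[-q^{\frac{i\nu+2}2}f(q^{-1}\bar z,z)+q^{-\frac{3i\nu}2+3}f(q\bar z,z)\bigr]$. These give a representation of the quantum Lorentz algebra that is unitary with respect to the Hermitian form $$\langle f|g\rangle=q^{i\nu-1}\iint\overline{f(\bar z,z)}\,g(q^{i\nu+1}\bar z,q^{i\nu-1}z)\,d\bar z\,dz,$$ in the sense that $\langle f|g.u\rangle=\langle S(u^* ).f|g\rangle$ for $u$ in the algebra generated by $A,B,C,A^{-1}$, where the antipode is $S(A^* )=(A^* )^{-1}$, $S(B^* )=-qB^*$, $S(C^* )=-q^{-1}C^*$. The group element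 is $g(A|H)=e^{\mathcal K\otimes2\phi}$ with $A=e^{\hbar\mathcal K}$, $H=e^\phi$, $\hbar=\ln q$; it acts on $V_\nu$ by $f(\bar z,z)\mapsto H^{i\nu-1}f(\bar z,H^{-2}z)$. *)

(* Defs.v *)
From HB Require Import structures.
From mathcomp Require Export all_boot all_order all_algebra.
From mathcomp Require Export complex.
From mathcomp Require Export all_classical all_reals all_analysis.

Set Implicit Arguments.
Unset Strict Implicit.
Unset Printing Implicit Defensive.

Import Order.TTheory GRing.Theory Num.Theory.
Local Open Scope ring_scope.
Local Open Scope complex_scope.

(* x ^ s = exp (s ln x), for x > 0 and a complex exponent s *)
Definition cpow (R : realType) (x : R) (s : R[i]) : R[i] :=
  let m := expR (complex.Re s * ln x) in
  let t := complex.Im s * ln x in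
  (m * cos t) +i* (m * sin t).

(* the purely imaginary number i nu *)
Definition inu (R : realType) (nu : R) : R[i] := 0 +i* nu.

(* Functions f (zb, z) of two independent complex variables; the value at the
   genuine point z of the plane is f z^* z.  *)
Definition bifun (R : realType) : Type := R[i] -> R[i] -> R[i].

(* The formulas below divide by z or zb, so identities between functions are
   required only off the axes zb = 0 and z = 0, where 0^-1 = 0 has no meaning. *)
Definition bieq (R : realType) (f g : bifun R) : Prop :=
  forall zb z : R[i], zb != 0 -> z != 0 -> f zb z = g zb z.

Section Operators.
Variables (R : realType) (q nu : R).
Implicit Type f : bifun R.

Local Notation i_nu := (inu nu).

Definition opA f : bifun R := fun zb z =>
  cpow q ((i_nu - 1) / 2) * f zb (q^-1%:C * z).

Definition opAinv f : bifun R := fun zb z =>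
  cpow q (- ((i_nu - 1) / 2)) * f zb (q%:C * z).

Definition opB f : bifun R := fun zb z =>
  cpow q (i_nu / 2) * ((f zb (q^-1%:C * z) - f zb (q%:C * z)) / (1 - q ^+ 2)%:C)
  * z^-1.

Definition opC f : bifun R := fun zb z =>
  z / (1 - q ^+ 2)%:C *
  (- cpow q ((i_nu + 2) / 2) * f zb (q^-1%:C * z)
   + cpow q (- (3 * i_nu / 2) + 3) * f zb (q%:C * z)).

(* the same formula as op, applied to the argument zb *)
Definition star (op : bifun R -> bifun R) f : bifun R := fun zb z =>
  op (fun w v => f v w) z zb.

(* f . A^m *)
Definition opApow (m : int) f : bifun R :=
  match m with
  | Posz n => iter n opA f
  | Negz n => iter n.+1 opAinv f
  end.

(* f . g(A|H), for H > 0 *)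
Definition opg (H : R) f : bifun R := fun zb z =>
  cpow H (i_nu - 1) * f zb ((H ^- 2)%:C * z).

Inductive gen := genA | genAinv | genB | genC.

(* f . u *)
Definition ract (u : gen) : bifun R -> bifun R :=
  match u with
  | genA => opA | genAinv => opAinv | genB => opB | genC => opC
  end.

(* u^* . f *)
Definition lact (u : gen) : bifun R -> bifun R := star (ract u).

(* S(u^* ) . f for the antipode S *)
Definition Slact (u : gen) f : bifun R :=
  match u with
  | genA => lact genAinv f
  | genAinv => lact genA f
  | genB => fun zb z => - q%:C * lact genB f zb z
  | genC => fun zb z => - q^-1%:C * lact genC f zb z
  end.

End Operators.

Section Form.
Variable R : realType.

(* The measure "dzb dz" on the plane is the area measure dx dy (z = x + i y);
   another normalization multiplies the form by a constant. *)
Definition area := ((@lebesgue_measure R) \x (@lebesgue_measure R))%E.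

Definition plane (p : R * R) : R[i] := p.1 +i* p.2.

Definition Cintegrable (F : R[i] -> R[i]) : Prop :=
  area.-integrable setT (fun p => (complex.Re (F (plane p)))%:E) /\
  area.-integrable setT (fun p => (complex.Im (F (plane p)))%:E).

Definition Cintegral (F : R[i] -> R[i]) : R[i] :=
  Rintegral area setT (fun p => complex.Re (F (plane p))) +i*
  Rintegral area setT (fun p => complex.Im (F (plane p))).

Variables q nu : R.

Definition integrand (f g : bifun R) (z : R[i]) : R[i] :=
  (f z^* z)^* *
  g (cpow q (inu nu + 1) * z^*) (cpow q (inu nu - 1) * z).

Definition form (f g : bifun R) : R[i] :=
  cpow q (inu nu - 1) * Cintegral (integrand f g).

(* f(zb, z) ~ c z^(i nu - 1) zb^(i nu - 1) as z -> oo, also after separate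
   rescalings of zb and z by positive reals *)
Definition asymptotics (f : bifun R) : Prop :=
  exists c : R[i], forall a b : R, 0 < a -> 0 < b ->
  forall e : R, 0 < e -> exists M : R, forall z : R[i], M < Normc.normc z ->
  Normc.normc (f (a%:C * z^*) (b%:C * z)
               / cpow (a * b * Normc.normc z ^+ 2) (inu nu - 1) - c) < e.

(* V is (a model of) the class-one principal series V_nu: a linear space of
   functions with the above asymptotics, on which the operators act and the
   form is a convergent Hermitian form making the representation unitary.
   As u |-> S(u^* ) reverses products twice, unitarity on generators extends
   to the algebra they generate. *)
Record principal_series (V : bifun R -> Prop) : Prop := PrincipalSeries {
  ps_zero : V (fun _ _ => 0) ;
  ps_linear : forall (k : R[i]) (f g : bifun R), V f -> V g ->
    V (fun zb z => k * f zb z + g zb z) ;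
  ps_asymptotics : forall f, V f -> asymptotics f ;
  ps_ract : forall u f, V f -> V (ract q nu u f) ;
  ps_lact : forall u f, V f -> V (lact q nu u f) ;
  ps_group : forall H f, 0 < H -> V f -> V (opg nu H f) ;
  ps_integrable : forall f g, V f -> V g -> Cintegrable (integrand f g) ;
  ps_hermitian : forall f g, V f -> V g -> form g f = (form f g)^* ;
  ps_unitary : forall u f g, V f -> V g ->
    form f (ract q nu u g) = form (Slact q nu u f) g
}.

End Form.

(* Main.v *)
(* Write G_H = psi_R . g(A|H). On V_nu the product of B and C is a three-term
   q-difference operator in z, and rescaling z by q^(+-2) in G_H amounts to
   rescaling H by q^(-+1), so that <psi_L | G_H . B C> is, up to a factor, the
   three-term combination of F. Moving C to the left and using
   C^* . psi_L = psi_L . B, then moving B to the right, turns this pairing into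
   <psi_L | B^* . G_H . B>. Since B^* . G_H . B = H^-2 (B^* . psi_R . B) . g(A|H),
   the equation for psi_R turns it into the remaining term. *)

Require Import Defs.
From mathcomp Require Import ring.

Import Order.TTheory GRing.Theory Num.Theory.
Local Open Scope ring_scope.
Local Open Scope complex_scope.

(** * Complex powers of a real base *)

Section Cpow.
Variable R : realType.
Implicit Types (x y : R) (s t : R[i]).

Lemma cpow0 x : cpow x 0 = 1.
Proof. by rewrite /cpow /= !mul0r expR0 cos0 sin0 mulr1 mulr0. Qed.

Lemma cpowD x s t : cpow x (s + t) = cpow x s * cpow x t.
Proof.
rewrite /cpow; case: s t => [a b] [c d] /=.
rewrite !mulrDl expRD cosD sinD; apply/eqP; rewrite eq_complex /=.
by apply/andP; split; apply/eqP; ring.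
Qed.

Lemma cpow_neq0 x s : cpow x s != 0.
Proof.
apply/eqP => s0; have := cpowD x s (- s); rewrite subrr cpow0 s0 mul0r.
by move/eqP; rewrite oner_eq0.
Qed.

Lemma cpowN x s : cpow x (- s) = (cpow x s)^-1.
Proof. by apply: (mulfI (cpow_neq0 x s)); rewrite -cpowD subrr cpow0 divff ?cpow_neq0. Qed.

Lemma cpow1 x : 0 < x -> cpow x 1 = x%:C.
Proof.
by move=> x0; rewrite /cpow /= mul1r mul0r cos0 sin0 lnK // mulr1 mulr0.
Qed.

Lemma cpowB x s t : cpow x (s - t) = cpow x s / cpow x t.
Proof. by rewrite cpowD cpowN. Qed.

Lemma cpow_natr x s n : cpow x (n%:R * s) = cpow x s ^+ n.
Proof.
elim: n => [|n IH]; first by rewrite mul0r cpow0 expr0.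
by rewrite -natr1 mulrDl mul1r cpowD IH exprSr.
Qed.

Lemma cpowM x y s : 0 < x -> 0 < y -> cpow (x * y) s = cpow x s * cpow y s.
Proof.
move=> x0 y0; rewrite /cpow lnM ?posrE // !mulrDr expRD cosD sinD.
by apply/eqP; rewrite eq_complex /=; apply/andP; split; apply/eqP; ring.
Qed.

Lemma cpow1l s : cpow 1 s = 1.
Proof. by rewrite /cpow ln1 !mulr0 expR0 cos0 sin0 mulr1 mulr0. Qed.

Lemma cpowVl x s : 0 < x -> cpow x^-1 s = (cpow x s)^-1.
Proof.
move=> x0; apply: (mulfI (cpow_neq0 x s)); rewrite -cpowM ?invr_gt0 //.
by rewrite divff ?gt_eqF // cpow1l divff ?cpow_neq0.
Qed.

Lemma cpow_exprz x s (m : int) : 0 < x -> cpow (x ^ m) s = cpow x s ^ m.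
Proof.
move=> x0.
have cX n : cpow (x ^+ n) s = cpow x s ^+ n.
  elim: n => [|n IH]; first by rewrite !expr0 cpow1l.
  by rewrite !exprS cpowM ?exprn_gt0 // IH.
case: m => n; first by rewrite -!exprnP cX.
by rewrite NegzE -!exprnN cpowVl ?exprn_gt0 // cX.
Qed.

End Cpow.

(** * Integrals over the plane: null sets and complex linearity *)

Section Area.
Variable R : realType.

(** Removing a null set from the domain changes neither integral, and the integrands agree on what
    remains. *)
Lemma eq_Rintegral_off_null d (T : measurableType d) (mu : {measure set T -> \bar R})
    (F G : T -> R) (iF : mu.-integrable setT (EFin \o F))
    (iG : mu.-integrable setT (EFin \o G)) (N : set T) :
  measurable N -> mu N = 0%E -> (forall x, ~ N x -> F x = G x) ->
  Rintegral mu setT F = Rintegral mu setT G.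
Proof.
move=> mN N0 FG; rewrite /Rintegral; congr fine.
rewrite (negligible_integral mN _ iF N0) // (negligible_integral mN _ iG N0) //.
by apply: eq_integral => x; rewrite inE => -[_ /= /FG ->].
Qed.

(** The origin is a product of two singletons, hence null for the product measure. *)
Lemma eq_area_integral_off0 (F G : R * R -> R) :
  (area (R := R)).-integrable setT (EFin \o F) ->
  (area (R := R)).-integrable setT (EFin \o G) ->
  (forall p, p != (0, 0) -> F p = G p) ->
  Rintegral (area (R := R)) setT F = Rintegral (area (R := R)) setT G.
Proof.
move=> iF iG FG.
apply: (eq_Rintegral_off_null _ _ _ _ _ iF iG ([set 0] `*` [set 0])%classic).
- by apply: measurableX; apply: measurable_set1.
- have -> : 0%E = ((@lebesgue_measure R) [set 0%R] * (@lebesgue_measure R) [set 0%R])%E :> \bar R.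
    by rewrite lebesgue_measure_set1 mul0e.
  apply: product_measure1E; exact: measurable_set1.
- by case=> a b ab; apply: FG; apply/eqP => -[a0 b0]; apply: ab; split.
Qed.

Lemma Cintegral_eq_off0 (F G : R[i] -> R[i]) :
  Cintegrable F -> Cintegrable G -> (forall z, z != 0 -> F z = G z) ->
  Cintegral F = Cintegral G.
Proof.
move=> [iF1 iF2] [iG1 iG2] FG.
have FGp p : p != (0, 0) -> F (plane p) = G (plane p).
  case: p => a b ab; apply: FG; apply: contra ab.
  by rewrite eq_complex xpair_eqE.
by congr (_ +i* _); apply: eq_area_integral_off0 => // p /FGp ->.
Qed.

Lemma CintegralD (F G : R[i] -> R[i]) : Cintegrable F -> Cintegrable G ->
  Cintegral (fun z => F z + G z) = Cintegral F + Cintegral G.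
Proof.
move=> [iF1 iF2] [iG1 iG2]; rewrite /Cintegral.
have -> : (fun p : R * R => complex.Re (F (plane p) + G (plane p))) =
    (fun p => complex.Re (F (plane p)) + complex.Re (G (plane p))).
  by apply/funext => p; case: (F _); case: (G _).
have -> : (fun p : R * R => complex.Im (F (plane p) + G (plane p))) =
    (fun p => complex.Im (F (plane p)) + complex.Im (G (plane p))).
  by apply/funext => p; case: (F _); case: (G _).
by rewrite !RintegralD.
Qed.

Lemma CintegrableZ (k : R[i]) (F : R[i] -> R[i]) :
  Cintegrable F -> Cintegrable (fun z => k * F z).
Proof.
case: k => a b [iF1 iF2]; split.
- have -> : (fun p : R * R => (complex.Re ((a +i* b) * F (plane p)))%:E) =
    ((fun p => a%:E * (complex.Re (F (plane p)))%:E) \+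
     (fun p => (- b)%:E * (complex.Im (F (plane p)))%:E))%E.
    apply/funext => p; rewrite -!EFinM -EFinD; congr EFin.
    by case: (F _) => c d /=; rewrite mulNr.
  by apply: integrableD => //; apply: integrableZl.
- have -> : (fun p : R * R => (complex.Im ((a +i* b) * F (plane p)))%:E) =
    ((fun p => a%:E * (complex.Im (F (plane p)))%:E) \+
     (fun p => b%:E * (complex.Re (F (plane p)))%:E))%E.
    by apply/funext => p; rewrite -!EFinM -EFinD; congr EFin; case: (F _).
  by apply: integrableD => //; apply: integrableZl.
Qed.

Lemma CintegralZ (k : R[i]) (F : R[i] -> R[i]) :
  Cintegrable F -> Cintegral (fun z => k * F z) = k * Cintegral F.
Proof.
case: k => a b [iF1 iF2]; rewrite /Cintegral.
have iZ (c : R) (f : R * R -> R) : (area (R := R)).-integrable setT (EFin \o f) ->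
    (area (R := R)).-integrable setT (EFin \o (fun p => c * f p)).
  by move=> fi; apply: (integrableZl measurableT c fi).
have -> : (fun p : R * R => complex.Re ((a +i* b) * F (plane p))) =
    (fun p => a * complex.Re (F (plane p)) - b * complex.Im (F (plane p))).
  by apply/funext => p; case: (F _).
have -> : (fun p : R * R => complex.Im ((a +i* b) * F (plane p))) =
    (fun p => a * complex.Im (F (plane p)) + b * complex.Re (F (plane p))).
  by apply/funext => p; case: (F _).
by rewrite RintegralB ?RintegralD ?RintegralZl //; apply: iZ.
Qed.

End Area.

(** * The operators and their interplay with the group element *)

Section Action.
Variables (R : realType) (q nu : R).
Hypothesis q_gt0 : 0 < q.
Implicit Types (f : bifun R) (H : R).

Let qC_neq0 : q%:C != 0.
Proof. by rewrite (inj_eq (@complexI R) q 0) gt_eqF. Qed.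

Lemma opApowE (m : int) f zb z : opApow q nu m f zb z =
  cpow q ((inu nu - 1) / 2) ^ m * f zb (q%:C ^ (- m) * z).
Proof.
case: m => n; rewrite /opApow.
  rewrite -exprnN -exprnP.
  elim: n z => [|n IH] z; first by rewrite !expr0 invr1 !mul1r.
  by rewrite iterS {1}/opA IH fmorphV !exprSr invfM !mulrA [cpow _ _ * _]mulrC.
rewrite NegzE opprK -exprnN -exprnP.
elim: n.+1 z => {n} [|n IH] z; first by rewrite !expr0 invr1 !mul1r.
by rewrite iterS {1}/opAinv IH cpowN !exprSr invfM !mulrA [_^-1 * _]mulrC.
Qed.

(** A^(2m) is the group element at q^m: it multiplies by (q^m)^(i nu - 1) and dilates z by (q^m)^-2.
    Group elements multiply, so H becomes q^m H. *)
Lemma opg_opApow (m : int) H f : 0 < H ->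
  opg nu H (opApow q nu (2 * m) f) = opg nu (q ^ m * H) f.
Proof.
move=> H0; apply/funext => zb; apply/funext => z.
rewrite /opg opApowE cpowM ?exprz_gt0 // cpow_exprz //.
rewrite -exprz_exp -exprnP -cpow_natr [_%:R * _]mulrC divfK ?pnatr_eq0 //.
rewrite mulrA [cpow H _ * _]mulrC [q%:C ^ _ * _]mulrA.
have -> : (q ^ m * H) ^- 2 = q ^ (- (2 * m)) * H ^- 2.
  by rewrite exprMn invfM (exprnN _ 2%N) exprz_exp mulrN [m * _]mulrC.
by rewrite rmorphM fmorphXz.
Qed.

Lemma opg_dilate a H f zb z : 0 < a -> 0 < H ->
  opg nu (a * H) f zb z = cpow a (inu nu - 1) * opg nu H f zb (a^-1%:C ^+ 2 * z).
Proof.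
move=> a0 H0; rewrite /opg cpowM //.
have -> : ((a * H) ^- 2)%:C = (H ^- 2)%:C * a^-1%:C ^+ 2.
  by rewrite -rmorphXn -rmorphM exprVn exprMn invfM [RHS]/= mulrC.
by rewrite !mulrA.
Qed.

(** The difference in B commutes with dilations of z, while its factor z^-1 has degree -1; moving it
    past z -> H^-2 z costs H^-2. *)
Lemma opB_opg H f : 0 < H ->
  opB q nu (opg nu H f) =
  (fun zb z => (H ^- 2)%:C * opg nu H (opB q nu f) zb z).
Proof.
move=> H0; apply/funext => zb; apply/funext => z; rewrite /opB /opg.
have h0 : (H ^- 2)%:C != 0.
  by rewrite (inj_eq (@complexI R) _ 0) invr_eq0 expf_neq0 ?gt_eqF.
set h := (H ^- 2)%:C in h0 *.
rewrite (invfM h) (mulrCA h q%:C) (mulrCA h q^-1%:C) -mulrBr.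
move: (f zb _ - f zb _) (1 - q ^+ 2)%:C^-1 (cpow H _) (cpow q _) => d k c a.
(* The identity is also claimed at z = 0, so only h is cancelled and z^-1 stays an opaque symbol. *)
suff -> : h * (c * (a * (d * k) * (h^-1 * z^-1))) = a * (c * d * k) * z^-1 * (h / h).
  by rewrite divff // mulr1.
by ring.
Qed.

(** B^* acts on zb and the dilation on z, so they commute and only the factor H^-2 from B
    appears. *)
Lemma star_opB_opB_opg H f zb z : 0 < H ->
  star (opB q nu) (opB q nu (opg nu H f)) zb z =
  (H ^- 2)%:C * (cpow H (inu nu - 1) *
    star (opB q nu) (opB q nu f) zb ((H ^- 2)%:C * z)).
Proof.
move=> H0; rewrite opB_opg // /star /opg; move: (opB q nu f) => g; rewrite /opB.
by ring.
Qed.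

(** The factor z of C cancels the z^-1 of B, evaluated at q^-1 z and q z, up to q and q^-1. The two
    differences of B then share the middle value f(zb, z). *)
Lemma opC_opB f : q != 1 -> bieq (opC q nu (opB q nu f))
  (fun zb z => q%:C ^+ 2 / (1 - q ^+ 2)%:C ^+ 2 *
    ((cpow q (inu nu) + cpow q (- inu nu)) * f zb z
     - cpow q (inu nu) * f zb (q^-1%:C ^+ 2 * z)
     - cpow q (- inu nu) * f zb (q%:C ^+ 2 * z))).
Proof.
move=> q1 zb z _ z0; rewrite /opC /opB.
have q2_neq0 : (1 - q ^+ 2)%:C != 0.
  rewrite (inj_eq (@complexI R) _ 0) subr_eq0 eq_sym sqrp_eq1 ?ltW //.
(* All powers are written in a = q^(i nu / 2) and q, which makes the identity rational in a, q and
   z. *)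
have -> : cpow q (inu nu) = cpow q (inu nu / 2) ^+ 2.
  by rewrite -cpow_natr mulrC divfK ?pnatr_eq0.
have -> : cpow q (- inu nu) = cpow q (inu nu / 2) ^- 2.
  by rewrite cpowN -cpow_natr [_ * (_ / _)]mulrC divfK ?pnatr_eq0.
have -> : cpow q ((inu nu + 2) / 2) = cpow q (inu nu / 2) * q%:C.
  by rewrite mulrDl divff ?pnatr_eq0 // cpowD cpow1.
have -> : cpow q (- (3 * inu nu / 2) + 3) = cpow q (inu nu / 2) ^- 3 * q%:C ^+ 3.
  by rewrite cpowD cpowN -mulrA cpow_natr -[X in _ * cpow q X]mulr1 cpow_natr cpow1.
have -> : q^-1%:C = (q%:C)^-1 by rewrite fmorphV.
have a0 := cpow_neq0 _ q (inu nu / 2).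
move: (cpow q _) a0 => a a0.
have qC0 := qC_neq0; have K0 := q2_neq0.
rewrite ![_ * (_ * z)]mulrA mulVf // divff // !mul1r -!expr2 -exprVn.
move: (q%:C) (1 - q ^+ 2)%:C qC0 K0 => p k p0 k0.
move: (f zb z) (f zb (p^-1 ^+ 2 * z)) (f zb (p ^+ 2 * z)) => x y w.
by field; rewrite a0 p0 k0 z0.
Qed.

End Action.

(** * Sesquilinearity of the form and transfer of B and C across it *)

Section Form.
Variables (R : realType) (q nu : R) (V : bifun R -> Prop).
Hypothesis V_ps : principal_series q nu V.
Implicit Types f g h : bifun R.

(** [bieq] says nothing on the axes, but the integrand only samples points whose coordinates are
    nonzero multiples of z^* and z. These meet an axis only at z = 0, a null set. *)
Lemma eq_form f f' g g' : V f -> V f' -> V g -> V g' ->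
  bieq f f' -> bieq g g' -> form q nu f g = form q nu f' g'.
Proof.
move=> Vf Vf' Vg Vg' ff' gg'; rewrite /form; congr (_ * _).
apply: Cintegral_eq_off0; [exact: ps_integrable V_ps _ _ _ _| |].
  exact: ps_integrable V_ps _ _ _ _.
move=> z z0; rewrite /integrand.
have zb0 : z^* != 0 by rewrite conjc_eq0.
by rewrite ff' // gg' // mulf_neq0 ?cpow_neq0.
Qed.

Lemma form_linr (k : R[i]) f g h : V f -> V g -> V h ->
  form q nu f (fun zb z => k * g zb z + h zb z) =
  k * form q nu f g + form q nu f h.
Proof.
move=> Vf Vg Vh; have ig := ps_integrable V_ps Vf Vg.
have ih := ps_integrable V_ps Vf Vh.
rewrite /form [k * (_ * _)]mulrCA -mulrDr; congr (_ * _).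
rewrite -CintegralZ // -CintegralD //; last exact: CintegrableZ.
by congr Cintegral; apply/funext => z; rewrite /integrand mulrDr mulrCA.
Qed.

Lemma form0r f : V f -> form q nu f (fun _ _ => 0) = 0.
Proof.
move=> Vf; have V0 := ps_zero V_ps; have := form_linr 1 f _ _ Vf V0 V0.
have -> : (fun _ _ : R[i] => 1 * 0 + 0) = (fun _ _ => 0 : R[i]).
  by apply/funext => zb; apply/funext => z; rewrite mulr0 addr0.
by rewrite mul1r -[LHS]addr0 => /addrI.
Qed.

Lemma form_scaler (k : R[i]) f g : V f -> V g ->
  form q nu f (fun zb z => k * g zb z) = k * form q nu f g.
Proof.
move=> Vf Vg; have := form_linr k f g _ Vf Vg (ps_zero V_ps).
rewrite form0r // addr0 => <-; congr form.
by apply/funext => zb; apply/funext => z; rewrite addr0.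
Qed.

Lemma ps_scale (k : R[i]) f : V f -> V (fun zb z => k * f zb z).
Proof.
move=> Vf; have := ps_linear V_ps k Vf (ps_zero V_ps); congr V.
by apply/funext => zb; apply/funext => z; rewrite addr0.
Qed.

Lemma form_scalel (k : R[i]) f g : V f -> V g ->
  form q nu (fun zb z => k * f zb z) g = k^* * form q nu f g.
Proof.
move=> Vf Vg; rewrite (ps_hermitian V_ps Vg (ps_scale k _ Vf)) form_scaler //.
by rewrite rmorphM [in RHS](ps_hermitian V_ps Vg Vf).
Qed.

(** Unitarity moves operators from right to left only; Hermitian symmetry before and after gives the
    opposite direction. The constant -q is conjugated twice and so returns unchanged. *)
Lemma form_Bl f g : V f -> V g ->
  form q nu (opB q nu f) g = - q%:C * form q nu f (star (opB q nu) g).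
Proof.
move=> Vf Vg.
have Vb u h : V h -> V (ract q nu u h) by apply: ps_ract.
have Vs u h : V h -> V (lact q nu u h) by apply: ps_lact.
rewrite (ps_hermitian V_ps Vg (Vb genB _ Vf)) (ps_unitary V_ps genB Vg Vf).
rewrite form_scalel //; last exact: (Vs genB).
rewrite rmorphM [X in X * _]conjcK.
by rewrite [in RHS](ps_hermitian V_ps (Vs genB _ Vg) Vf).
Qed.

Lemma form_Cr f g : V f -> V g ->
  form q nu f (opC q nu g) = - q^-1%:C * form q nu (star (opC q nu) f) g.
Proof.
move=> Vf Vg; rewrite (ps_unitary V_ps genC Vf Vg) form_scalel //; last first.
  exact: (ps_lact V_ps genC).
by rewrite rmorphN [X in - X * _]conjc_real.
Qed.

Lemma ps_opApow (m : int) f : V f -> V (opApow q nu m f).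
Proof.
move=> Vf; case: m => n; rewrite /opApow.
  by elim: n => [|n IH] //; exact: (ps_ract V_ps genA).
by elim: n.+1 => {n} [|n IH] //; exact: (ps_ract V_ps genAinv).
Qed.

End Form.

(** * The difference equation, from two evaluations of one pairing *)

Theorem proposition6p1 (R : realType) (q nu : R) (mu : R[i]) (delta : nat)
    (V : bifun R -> Prop) (psiL psiR : bifun R)
    (q_gt0 : 0 < q) (q_neq1 : q != 1) (delta_le2 : (delta <= 2)%N)
    (V_ps : principal_series q nu V)
    (V_psiL : V psiL) (V_psiR : V psiR)
    (eq_psiL : bieq (star (opC q nu) psiL) (opB q nu psiL))
    (eq_psiR : bieq (star (opB q nu) (opB q nu psiR))
       (fun zb z => - (mu^* * mu * q%:C ^ (1 - delta%:Z)) *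
                    opApow q nu (2 * (delta%:Z - 1)) psiR zb z)) :
  let F (H : R) : R[i] := form q nu psiL (opg nu H psiR) in
  forall H : R, 0 < H ->
    (q%:C * F (q * H) - (cpow q (inu nu) + cpow q (- inu nu)) * F H
       + q^-1%:C * F (q^-1 * H)) / (1 - q ^+ 2)%:C ^+ 2
    - mu^* * mu * q%:C ^ (- delta%:Z - 1) * (H ^- 2)%:C
      * F (q ^ (delta%:Z - 1) * H) = 0.
Proof.
move=> F H H0.
have ps_B f : V f -> V (opB q nu f) by apply: (ps_ract V_ps genB).
have ps_C f : V f -> V (opC q nu f) by apply: (ps_ract V_ps genC).
have ps_Bs f : V f -> V (star (opB q nu) f) by apply: (ps_lact V_ps genB).
have ps_Cs f : V f -> V (star (opC q nu) f) by apply: (ps_lact V_ps genC).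
have qH0 : 0 < q * H by rewrite mulr_gt0.
have q'H0 : 0 < q^-1 * H by rewrite mulr_gt0 ?invr_gt0.
set G := fun H : R => opg nu H psiR.
have VG K : 0 < K -> V (G K) by move=> K0; apply: ps_group V_ps _ _ K0 V_psiR.
have qC0 : q%:C != 0 by rewrite (inj_eq (@complexI R) q 0) gt_eqF.
have VB : V (opB q nu (G H)) by apply/ps_B/VG.
set s := cpow q (inu nu) + cpow q (- inu nu).
set c := q%:C ^+ 2 / (1 - q ^+ 2)%:C ^+ 2.
have three_term : form q nu psiL (opC q nu (opB q nu (G H))) =
  - c * (q%:C * F (q * H) - s * F H + q^-1%:C * F (q^-1 * H)).
  (* Linearity of the form rests on convergent integrals, so every partial sum must be shown to lie
     in V. *)
  have scaleV k K : 0 < K -> V (fun zb z => k * G K zb z).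
    by move=> K0; apply: (ps_scale _ _ _ _ V_ps); apply: VG.
  have V2 : V (fun zb z => - s * G H zb z + q^-1%:C * G (q^-1 * H) zb z).
    by apply: (ps_linear V_ps); [apply: VG|apply: scaleV].
  have V3 : V (fun zb z => q%:C * G (q * H) zb z
      + (- s * G H zb z + q^-1%:C * G (q^-1 * H) zb z)).
    by apply: (ps_linear V_ps); [apply: VG|].
  transitivity (form q nu psiL (fun zb z => - c * (q%:C * G (q * H) zb z
      + (- s * G H zb z + q^-1%:C * G (q^-1 * H) zb z)))).
    apply: (eq_form _ _ _ _ V_ps) => //; first exact: ps_C.
      exact: (ps_scale _ _ _ _ V_ps).
    (* By [opg_dilate] at q and q^-1, q^(i nu) G_H(zb, q^-2 z) = q G_(qH)(zb, z) and q^(-i nu)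
       G_H(zb, q^2 z) = q^-1 G_(H/q)(zb, z). *)
    move=> zb z zb0 z0; rewrite opC_opB // -/c -/s.
    rewrite /G !opg_dilate ?invr_gt0 // invrK cpowVl // cpowB cpow1 // invfM invrK.
    rewrite /s cpowN fmorphV; have := cpow_neq0 _ q (inu nu).
    move: (cpow q _) (opg _ _ _ _ _) (opg _ _ _ _ _) (opg _ _ _ _ _) => x u v w x0.
    by field; rewrite x0.
  rewrite (form_scaler _ _ _ _ V_ps _ psiL _ V_psiL V3).
  rewrite (form_linr _ _ _ _ V_ps _ psiL _ _ V_psiL (VG _ qH0) V2).
  rewrite (form_linr _ _ _ _ V_ps _ psiL _ _ V_psiL (VG _ H0) (scaleV _ _ q'H0)).
  rewrite (form_scaler _ _ _ _ V_ps _ psiL _ V_psiL (VG _ q'H0)).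
  by rewrite (mulNr s) addrA.
have pairing : form q nu psiL (opC q nu (opB q nu (G H))) =
    form q nu psiL (star (opB q nu) (opB q nu (G H))).
  rewrite (form_Cr _ _ _ _ V_ps psiL _ V_psiL VB).
  rewrite (eq_form _ _ _ _ V_ps (star (opC q nu) psiL) (opB q nu psiL) _ _
             (ps_Cs _ V_psiL) (ps_B _ V_psiL) VB VB eq_psiL (fun _ _ _ _ => erefl)).
  (* The antipode constants -q^-1, from moving C left, and -q, from moving B right, cancel. *)
  rewrite (form_Bl _ _ _ _ V_ps _ _ V_psiL VB) mulrA mulrNN.
  by rewrite -rmorphM mulVf ?gt_eqF // mul1r.
have reflection : form q nu psiL (star (opB q nu) (opB q nu (G H))) =
  - (mu^* * mu * q%:C ^ (1 - delta%:Z)) * (H ^- 2)%:C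
      * F (q ^ (delta%:Z - 1) * H).
  (* The shift of H by q^(delta - 1) is read back as A^(2(delta - 1)) acting on psi_R, the form in
     which [eq_psiR] supplies it. *)
  rewrite /F -opg_opApow // -mulrA -(form_scaler _ _ _ _ V_ps _ psiL) //; last first.
    by apply: (ps_group V_ps) => //; apply: (ps_opApow _ _ _ _ V_ps).
  rewrite -(form_scaler _ _ _ _ V_ps _ psiL) //; last first.
    apply: (ps_scale _ _ _ _ V_ps).
    by apply: (ps_group V_ps) => //; apply: (ps_opApow _ _ _ _ V_ps).
  apply: (eq_form _ _ _ _ V_ps) => //; first exact: ps_Bs.
    do 2! apply: (ps_scale _ _ _ _ V_ps).
    by apply: (ps_group V_ps) => //; apply: (ps_opApow _ _ _ _ V_ps).
  move=> zb z zb0 z0.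
  have h0 : (H ^- 2)%:C != 0.
    by rewrite (inj_eq (@complexI R) _ 0) invr_eq0 expf_neq0 ?gt_eqF.
  (* The equation for psi_R is used at (zb, H^-2 z), which is off the axes because H^-2 is
     nonzero. *)
  rewrite /G star_opB_opB_opg // eq_psiR ?mulf_neq0 // /opg.
  move: (mu^* * mu * _) (opApow _ _ _ _ _ _) => k y.
  by ring.
have K0 : (1 - q ^+ 2)%:C != 0.
  by rewrite (inj_eq (@complexI R) _ 0) subr_eq0 eq_sym sqrp_eq1 ?ltW.
(* The missing q^-2 is the q^2 in the factor c of the three-term side. *)
have -> : q%:C ^ (- delta%:Z - 1) = q%:C ^ (1 - delta%:Z) / q%:C ^+ 2.
  rewrite exprnN -expfzDr //; congr (_ ^ _); ring.
move: three_term; rewrite pairing reflection /c -/s.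
move: (q%:C * F _ - _ + _) (F _) (q%:C ^ (1 - _)) (H ^- 2)%:C => X Y k h.
move: (q%:C) ((1 - q ^+ 2)%:C) qC0 K0 => p K p0 K0 E.
(* After multiplication by -q^2 the first term is -c times the three-term combination, which E
   equates with the other evaluation of the pairing. *)
apply: (mulfI (_ : - (p ^+ 2) != 0)); first by rewrite oppr_eq0 expf_neq0.
rewrite mulr0 mulrBr [X in X - _](_ : _ = - (p ^+ 2 / K ^+ 2) * X); last by ring.
by rewrite -E; field.
Qed.
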